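(* $F_0^I(x,y,q)=1$, $F_1^I(x,y,q)=x$, and for $n\geq 2$, $$F_n^I(x,y,q)=xq^{n-1}F_{n-1}^I(x,y,q)+yq^{2(n-2)}F_{n-2}^I(x,y,q).$$
   Context: $S_n(123,132,213)$ denotes the set of permutations of $[n]=\{1,\dots,n\}$ containing no subsequence order isomorphic to $123$, $132$ or $213$. For a permutation $\pi$, split $\pi$ into its maximal increasing runs of consecutive entries (for $\pi\in S_n(123,132,213)$ these are the layers of $\pi$, which is a reverse layered matching: a concatenation of increasing blocks of size $1$ or $2$, each block larger than all later blocks). Let $s(\pi)$ be the number of such runs of length $1$ (singletons) and $d(\pi)$ the number of length $2$ (doubletons). $inv(\pi)$ is the number of pairs $i<j$ with $p_i>p_j$. Define $F_n^I(x,y,q)=\sum_{\pi\in S_n(123,132,213)}x^{s(\pi)}y^{d(\pi)}q^{inv(\pi)}$. *)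

(* Defs.v *)
From mathcomp Require Import all_boot all_order all_algebra all_fingroup.

Set Implicit Arguments.
Unset Strict Implicit.
Unset Printing Implicit Defensive.

Import GRing.Theory.

(* One-line notation. Entries are shifted down by one: [n] = {1, ..., n} is
   replaced by 'I_n = {0, ..., n-1}, which changes neither pattern containment,
   nor ascending runs, nor inversions. *)
Definition word (n : nat) (p : 'S_n) : seq nat := [seq val (p i) | i <- enum 'I_n].

Definition order_iso (s t : seq nat) : bool :=
  (size s == size t) &&
  [forall i : 'I_(size s), forall j : 'I_(size s),
     (nth 0 s i < nth 0 s j) == (nth 0 t i < nth 0 t j)].

(* The subsequences of s are the mask m s, for m a bit mask of length size s. *)
Definition contains (s t : seq nat) : bool :=
  [exists m : (size s).-tuple bool, order_iso (mask m s) t].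

Definition avoiders (n : nat) (ts : seq (seq nat)) : {set 'S_n} :=
  [set p : 'S_n | all (fun t => ~~ contains (word p) t) ts].

Definition patterns : seq (seq nat) :=
  [:: [:: 1; 2; 3]; [:: 1; 3; 2]; [:: 2; 1; 3]].

(* Decomposition of a word into its maximal increasing runs of consecutive
   entries. *)
Fixpoint runs (s : seq nat) : seq (seq nat) :=
  if s is a :: s' then
    match runs s' with
    | (b :: r) :: rs =>
        if a < b then (a :: b :: r) :: rs else [:: a] :: (b :: r) :: rs
    | _ => [:: [:: a]]
    end
  else [::].

Definition nb_runs (k n : nat) (p : 'S_n) : nat :=
  count (fun r => size r == k) (runs (word p)).

Definition singletons (n : nat) (p : 'S_n) : nat := nb_runs 1 p.

Definition doubletons (n : nat) (p : 'S_n) : nat := nb_runs 2 p.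

Definition inversions (n : nat) (p : 'S_n) : nat :=
  #|[set ij : 'I_n * 'I_n | (ij.1 < ij.2) && (p ij.2 < p ij.1)]|.

Local Open Scope ring_scope.

(* Taking R = Z[X, Y, Q] and x, y, q its variables gives the generating
   polynomial itself. *)
Definition FI (R : comNzRingType) (n : nat) (x y q : R) : R :=
  \sum_(p in avoiders n patterns)
     x ^+ singletons p * y ^+ doubletons p * q ^+ inversions p.

(* Main.v *)
Require Import Defs.
From mathcomp Require Import all_boot all_order all_algebra all_fingroup.
From mathcomp Require Import zify ring.

Import GRing.Theory.

(** A triple [a, b, c] of distinct entries forms one of the three patterns
    exactly when [a < c], so avoidance says that an entry exceeds everything
    to its right except possibly its right neighbour. Hence the maximum of
    such a word comes first, or second right after the second largest entry,
    and what follows is an arbitrary avoider. *)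

(** * Pattern avoidance as a condition on triples *)

Definition near_descending (s : seq nat) : Prop :=
  forall a b c, subseq [:: a; b; c] s -> c <= a.

(** The three diagonal comparisons always agree; the other six are inequalities within reach of
    [lia]. *)
Lemma order_iso3 a b c x y z :
  order_iso [:: a; b; c] [:: x; y; z] =
  [&& (a < b) == (x < y), (a < c) == (x < z), (b < a) == (y < x),
      (b < c) == (y < z), (c < a) == (z < x) & (c < b) == (z < y)].
Proof.
rewrite /order_iso /=; apply/forallP/idP => [iso|].
  have := iso (inord 0) => /forallP iso0.
  have := iso (inord 1) => /forallP iso1.
  have := iso (inord 2) => /forallP iso2.
  have := (iso0 (inord 1), iso0 (inord 2), iso1 (inord 0), iso1 (inord 2),
           iso2 (inord 0), iso2 (inord 1)).
  by rewrite !inordK //= => -[[[[[-> ->] ->] ->] ->] ->].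
case/and5P=> ab ac ba bc /andP[ca cb] [[|[|[|i]]] //= _];
  by apply/forallP => -[[|[|[|j]]] //= _]; rewrite ?ltnn.
Qed.

Lemma containsP3 s x y z :
  reflect (exists a b c, subseq [:: a; b; c] s /\
                         order_iso [:: a; b; c] [:: x; y; z])
          (contains s [:: x; y; z]).
Proof.
apply: (iffP existsP) => [[m iso]|[a [b [c [/subseqP[m szm sabc] iso]]]]].
  have /andP[/eqP sz3 _] := iso.
  case def_s: (mask m s) sz3 iso => [|a [|b [|c [|]]]] //= _ iso.
  by exists a, b, c; rewrite -def_s mask_subseq def_s.
by exists (Tuple (introT eqP szm)); rewrite /= -sabc.
Qed.

Lemma avoids_patternsP s : uniq s ->
  reflect (near_descending s) (all (fun t => ~~ contains s t) patterns).
Proof.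
move=> uniq_s; apply: (iffP idP) => [|desc].
  rewrite /patterns /= andbT => /and3P[no123 no132 no213] a b c sub_abc.
  rewrite leqNgt; apply/negP => lt_ac.
  have := subseq_uniq sub_abc uniq_s; rewrite /= !inE => uniq_abc.
  (* Given [a < c], the pattern is 123, 132 or 213 as [b] lies between, above or below; [uniq_abc]
     excludes ties. *)
  case: (ltnP a b) => [lt_ab|le_ba]; [case: (ltnP b c) => [lt_bc|le_cb]|].
  - by case/containsP3: no123; exists a, b, c; rewrite order_iso3; split=> //; lia.
  - by case/containsP3: no132; exists a, b, c; rewrite order_iso3; split=> //; lia.
  - by case/containsP3: no213; exists a, b, c; rewrite order_iso3; split=> //; lia.
(* Each pattern has its first entry below its last, against [c <= a]. *)
rewrite /patterns /= andbT; apply/and3P; split; apply/containsP3;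
  by move=> [a [b [c [/desc]]]]; rewrite order_iso3; lia.
Qed.

(** The new triples start with [x]. Their last entry lies beyond the head of [s], and conversely
    that head can serve as the middle entry. *)
Lemma near_descending_cons x s :
  near_descending (x :: s) <->
  near_descending s /\ {in behead s, forall c, c <= x}.
Proof.
split=> [desc|[desc le_x] a b c /=].
  split=> [a b c sub_s|].
    exact: desc (subseq_trans sub_s (subseq_cons s x)).
  case: s desc => //= b s desc c s_c.
  by apply: (desc x b c); rewrite /= !eqxx sub1seq.
case: eqP => [->|_ /desc //] sub_bc; apply: le_x.
case: s sub_bc {desc} => //= d s; rewrite -sub1seq.
by case: eqP => _ //; apply: subseq_trans (subseq_cons [:: c] b).
Qed.

(** * Recursive enumeration of the avoiders *)

Fixpoint layered (n : nat) : seq (seq nat) :=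
  if n isn't n1.+1 then [:: [::]] else
  if n1 isn't n2.+1 then [:: [:: 0]] else
  map (cons n1) (layered n1) ++ map (fun s => n2 :: n1 :: s) (layered n2).

Lemma layeredSS n :
  layered n.+2 = map (cons n.+1) (layered n.+1) ++
                 map (fun s => n :: n.+1 :: s) (layered n).
Proof. by []. Qed.

Lemma nat_ind2 (P : nat -> Prop) :
  P 0 -> P 1 -> (forall n, P n -> P n.+1 -> P n.+2) -> forall n, P n.
Proof.
move=> P0 P1 PS n; suff: P n /\ P n.+1 by case.
by elim: n => [|n [Pn Pn1]]; split=> //; apply: PS.
Qed.

Lemma uniq_layered n : uniq (layered n).
Proof.
elim/nat_ind2: n => // n IH0 IH1.
rewrite layeredSS cat_uniq !map_inj_uniq ?IH0 ?IH1 ?andbT; first last.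
- by move=> s t [].
- by move=> s t [].
(* The two families are disjoint: their words start with [n.+1] and with [n]. *)
by apply/hasPn => _ /mapP[s _ ->]; apply/negP => /mapP[t _ []]; lia.
Qed.

Lemma iota0S n : perm_eq (iota 0 n.+1) (n :: iota 0 n).
Proof. by rewrite -addn1 iotaD cats1 perm_rcons. Qed.

Lemma perm_iota_cons n s :
  perm_eq (n :: s) (iota 0 n.+1) = perm_eq s (iota 0 n).
Proof. by rewrite (permPr (iota0S n)) perm_cons. Qed.

Lemma perm_iota_cons2 n s :
  perm_eq (n :: n.+1 :: s) (iota 0 n.+2) = perm_eq s (iota 0 n).
Proof.
have swap : perm_eq (n :: n.+1 :: s) (n.+1 :: n :: s).
  by rewrite (perm_catCA [:: n] [:: n.+1] s).
by rewrite (permPl swap) !perm_iota_cons.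
Qed.

Lemma perm_iota_lt {n s} : perm_eq s (iota 0 n) -> {in s, forall a, a < n}.
Proof. by move=> /perm_mem mem_s a; rewrite mem_s mem_iota. Qed.

(** An entry in third place or later is at most the first one. This keeps [n.+1] out of those
    places; if [n.+1] comes second, it keeps [n] out of them too. *)
Lemma near_descending_shape n s :
  perm_eq s (iota 0 n.+2) -> near_descending s ->
  (exists t, s = n.+1 :: t) \/ (exists t, s = n :: n.+1 :: t).
Proof.
move=> perm_s desc; have mem_s := perm_mem perm_s.
have uniq_s : uniq s by rewrite (perm_uniq perm_s) iota_uniq.
have lt_s := perm_iota_lt perm_s.
have top_s : n.+1 \in s by rewrite mem_s mem_iota; lia.
have n_s : n \in s by rewrite mem_s mem_iota; lia.
case: s {perm_s mem_s} desc uniq_s lt_s top_s n_s => // a [|b t] desc uniq_s lt_s.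
  by rewrite inE => /eqP <-; left; exists [::].
have /near_descending_cons[_ /= le_a] := desc.
rewrite !inE => /or3P[/eqP <-|/eqP def_b|/le_a le_na].
- by left; exists (b :: t).
- subst b; case/or3P => [/eqP <-|/eqP|/le_a le_na]; [by right; exists t|lia|].
  have := lt_s a; rewrite inE eqxx => /(_ isT) lt_a.
  have {lt_a} [def_a|def_a] : a = n \/ a = n.+1 by lia.
    by subst a; right; exists t.
  by move: uniq_s; rewrite /= inE def_a eqxx.
(* Here [n.+1 <= a < n.+2] makes [a] the maximum, which is already the first alternative. *)
- have := lt_s a; rewrite inE eqxx => /(_ isT) lt_a _.
  by left; exists (b :: t); congr (_ :: _); lia.
Qed.

Lemma mem_layeredP n s :
  s \in layered n <-> perm_eq s (iota 0 n) /\ near_descending s.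
Proof.
elim/nat_ind2: n s => [s|s|n IH0 IH1 s].
- rewrite inE; split=> [/eqP ->|[/perm_nilP ->]] //; by split=> // a b c.
- rewrite inE; split=> [/eqP ->|[perm_s _]].
    by split=> // a b c /size_subseq.
  by apply/eqP/perm_small_eq.
rewrite layeredSS mem_cat; split.
  case/orP=> /mapP[t /[!(IH0, IH1)] -[perm_t desc_t] ->].
    rewrite perm_iota_cons; split=> //.
    apply/near_descending_cons; split=> // c /mem_behead /(perm_iota_lt perm_t).
    by lia.
  rewrite perm_iota_cons2; split=> //.
  (* Only entries after [n.+1] are compared with [n], so the initial ascent is harmless. *)
  apply/near_descending_cons; split; last first.
    by move=> c /= /(perm_iota_lt perm_t); lia.
  apply/near_descending_cons; split=> // c /mem_behead /(perm_iota_lt perm_t).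
  by lia.
case=> perm_s desc; apply/orP.
case: (near_descending_shape n s perm_s desc) => -[t def_s]; subst s.
  left; apply: map_f; apply/IH1; move: perm_s; rewrite perm_iota_cons => ->.
  by case/near_descending_cons: desc.
right; apply/mapP; exists t => //; apply/IH0.
move: perm_s; rewrite perm_iota_cons2 => ->.
by case/near_descending_cons: desc => /near_descending_cons[].
Qed.

(** * Permutations and their words *)

Lemma size_word n (p : 'S_n) : size (word p) = n.
Proof. by rewrite size_map size_enum_ord. Qed.

Lemma nth_word [n] (p : 'S_n) (i : 'I_n) : nth 0 (word p) i = p i.
Proof. by rewrite (nth_map i) ?size_enum_ord // nth_ord_enum. Qed.

Lemma word_inj n : injective (@word n).
Proof.
by move=> p r eq_pr; apply/permP => i; apply: val_inj; rewrite /= -!nth_word eq_pr.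
Qed.

Lemma perm_word [n] (p : 'S_n) : perm_eq (word p) (iota 0 n).
Proof.
apply: uniq_perm (iota_uniq 0 n) _.
  by rewrite map_inj_uniq ?enum_uniq // => i j /val_inj/perm_inj.
move=> a; rewrite mem_iota /=; apply/mapP/idP => [[i _ ->]|lt_an].
  exact: ltn_ord.
exists (p^-1 (Ordinal lt_an))%g; first by rewrite mem_enum.
by rewrite permKV.
Qed.

Lemma word_surj n s : perm_eq s (iota 0 n) -> exists p : 'S_n, word p = s.
Proof.
move=> perm_s; have size_s : size s = n by rewrite (perm_size perm_s) size_iota.
have lt_s (i : 'I_n) : nth 0 s i < n.
  by apply: perm_iota_lt perm_s _ _; rewrite mem_nth ?size_s.
have inj_s : injective (fun i => Ordinal (lt_s i)).
  move=> i j [] /eqP; rewrite nth_uniq ?size_s // => [/eqP/val_inj //|].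
  by rewrite (perm_uniq perm_s) iota_uniq.
exists (perm inj_s); apply: (@eq_from_nth _ 0); rewrite size_word ?size_s //.
by move=> i lt_in; rewrite (nth_word (perm inj_s) (Ordinal lt_in)) permE.
Qed.

(** Both lists are duplicate-free with the same members, so a sum over avoiders can be reindexed by
    [layered n]. *)
Lemma perm_word_avoiders n :
  perm_eq [seq word p | p in avoiders n patterns] (layered n).
Proof.
apply: uniq_perm (uniq_layered n) _.
  by rewrite map_inj_uniq ?enum_uniq //; apply: word_inj.
have uniq_word (p : 'S_n) : uniq (word p).
  by rewrite (perm_uniq (perm_word p)) iota_uniq.
move=> s; apply/mapP/idP => [[p + ->]|/mem_layeredP[/word_surj[p <-] desc]].
  rewrite mem_enum inE => /(avoids_patternsP _ (uniq_word p)) desc.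
  by apply/mem_layeredP; rewrite perm_word.
by exists p => //; rewrite mem_enum inE; apply/avoids_patternsP.
Qed.

(** * Inversions and runs of words *)

Fixpoint invs (s : seq nat) : nat :=
  if s is a :: t then count (fun b => b < a) t + invs t else 0.

(** Stated for arbitrary [f] because the induction drops the first index, and the restriction of a
    permutation is no longer one. *)
Lemma sum_inversions n (f : 'I_n -> nat) :
  \sum_(i < n) \sum_(j < n) ((i < j) && (f j < f i)) =
  invs [seq f i | i <- enum 'I_n].
Proof.
elim: n f => [|n IH] f; first by rewrite big_ord0 (size0nil (size_enum_ord 0)).
rewrite enum_ordSl /= -map_comp -(IH (f \o lift ord0)) big_ord_recl; congr (_ + _).
  rewrite big_ord_recl ltnn add0n -sum1_count big_map big_enum_cond /= [RHS]big_mkcond.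
  by apply: eq_bigr => i _ /=; case: (_ < _).
(* The column of index 0 vanishes, since no index precedes 0. *)
by apply: eq_bigr => i _; rewrite big_ord_recl /= add0n.
Qed.

Lemma inversions_word n (p : 'S_n) : inversions p = invs (word p).
Proof.
rewrite -(sum_inversions n (fun i => p i)) pair_big /= /inversions -sum1_card.
by rewrite big_mkcond; apply: eq_bigr => -[i j] _; rewrite inE /=; case: andP.
Qed.

(** Exposes the head of the first run, on which the match in [runs] depends. *)
Lemma runs_cons a s : exists r rs, runs (a :: s) = (a :: r) :: rs.
Proof.
rewrite /=; case: (runs s) => [|[|b r] rs]; try by exists [::], [::].
by case: ifP => _; [exists (b :: r), rs | exists [::], ((b :: r) :: rs)].
Qed.

Lemma runs_cons_descent a s :
  {in s, forall b, b <= a} -> runs (a :: s) = [:: a] :: runs s.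
Proof.
case: s => //= b s le_a; have [r [rs /= ->]] := runs_cons b s.
by rewrite ltnNge le_a ?mem_head.
Qed.

Lemma runs_cons_ascent a b s :
  a < b -> {in s, forall c, c <= b} ->
  runs (a :: b :: s) = [:: a; b] :: runs s.
Proof. by move=> lt_ab /runs_cons_descent /= ->; rewrite lt_ab. Qed.

(** * Weights of words and the recurrence *)

Local Open Scope ring_scope.

Definition weight [R : comNzRingType] (x y q : R) (s : seq nat) : R :=
  x ^+ count (fun r => size r == 1%N) (runs s) *
  y ^+ count (fun r => size r == 2%N) (runs s) * q ^+ invs s.

Lemma FI_layered (R : comNzRingType) n (x y q : R) :
  FI n x y q = \sum_(s <- layered n) weight x y q s.
Proof.
rewrite -(perm_big _ (perm_word_avoiders n)) big_map big_enum /=.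
by apply: eq_bigr => p _; rewrite inversions_word.
Qed.

(** The bound [m] is separate from [n] because a doubleton compares the later entries with both [n]
    and [n.+1]. *)
Lemma count_lt_iota n m s :
  (n <= m)%N -> perm_eq s (iota 0 n) -> count (fun b => (b < m)%N) s = n.
Proof.
move=> le_nm perm_s; rewrite -[RHS](size_iota 0) -(perm_size perm_s).
by apply/eqP; rewrite -all_count; apply/allP => a /(perm_iota_lt perm_s); lia.
Qed.

(** The entry [n] is a run of its own and forms an inversion with each of the [n] later entries. *)
Lemma weight_singleton (R : comNzRingType) (x y q : R) n s :
  perm_eq s (iota 0 n) ->
  weight x y q (n :: s) = x * q ^+ n * weight x y q s.
Proof.
move=> perm_s; have lt_s := perm_iota_lt perm_s.
rewrite /weight runs_cons_descent => [|b /lt_s]; last exact: ltnW.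
by rewrite /= (count_lt_iota n) // add0n add1n exprS exprD; ring.
Qed.

(** Each of the two leading entries exceeds all [n] entries of [s], and they form no inversion with
    each other. *)
Lemma weight_doubleton (R : comNzRingType) (x y q : R) n s :
  perm_eq s (iota 0 n) ->
  weight x y q (n :: n.+1 :: s) = y * q ^+ (2 * n) * weight x y q s.
Proof.
move=> perm_s; have lt_s := perm_iota_lt perm_s.
have runs_ns : runs (n :: n.+1 :: s) = [:: n; n.+1] :: runs s.
  by apply: runs_cons_ascent => // b /lt_s; lia.
rewrite /weight runs_ns /= ltnNge leqnSn /= !(count_lt_iota n) //.
by rewrite !add0n add1n addnA addnn -mul2n exprS exprD; ring.
Qed.

Theorem theorem2p1 (R : comNzRingType) (x y q : R) :
  FI 0 x y q = 1 /\
  FI 1 x y q = x /\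
  (forall n : nat, (2 <= n)%N ->
     FI n x y q = x * q ^+ (n - 1) * FI (n - 1) x y q
                  + y * q ^+ (2 * (n - 2)) * FI (n - 2) x y q).
Proof.
split; [|split].
- by rewrite FI_layered big_seq1 /weight !mulr1.
- by rewrite FI_layered big_seq1 /weight /= !mulr1.
(* From here the index is [n.+2], so the exponents of [q] become [n.+1] and [2 * n]. *)
case=> [|[|n]] // _; rewrite subSS subn0 !subSS subn0 !FI_layered.
rewrite layeredSS big_cat !big_map !mulr_sumr.
(* Membership in [layered] is kept under the sums: it gives the [perm_eq] required by the weight
   lemmas. *)
congr (_ + _); rewrite big_seq [RHS]big_seq;
  apply: eq_bigr => s /mem_layeredP[perm_s _].
  exact: weight_singleton.
exact: weight_doubleton.
Qed.
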